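(* Let $S$ be a groupoid with a left identity element $l$, and suppose that $S$ is ${}'$-unary for a unary operation ${}'$ on $S$. Then $x'=xl$ for all $x\in S$. Furthermore, $[S]'$ is a semiheap if and only if $S$ is a right modular groupoid.
   Context: A groupoid is a set with a binary operation, written as juxtaposition. A left identity is an element $l$ with $lx=x$ for all $x$. Given a unary operation ${}'$ on $S$, the groupoid $S$ is called ${}'$-unary if $(x')'=x$, $(xy)'=x'y'$ and $x'y=y'x$ for all $x,y\in S$. $[S]'$ denotes $S$ with the ternary operation $[abc]'=(ab')c$. A groupoid is right modular if $(xy)z=(zy)x$ for all $x,y,z$. A ternary operation $[\ ]$ is a semiheap if $[[xyz]uv]=[x[uzy]v]=[xy[zuv]]$ for all $x,y,z,u,v$. *)

(* Defs.v *)
(* A groupoid is an arbitrary type [S] with a binary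
   operation [op]; no decidability or choice structure is assumed on [S]. *)
From mathcomp Require Import all_boot.
Set Implicit Arguments.
Unset Strict Implicit.
Unset Printing Implicit Defensive.

Definition is_unary_groupoid (S : Type) (op : S -> S -> S) (prime : S -> S) : Prop :=
  [/\ involutive prime,
      {morph prime : x y / op x y}
    & forall x y : S, op (prime x) y = op (prime y) x].

Definition ternary_of (S : Type) (op : S -> S -> S) (prime : S -> S) : S -> S -> S -> S :=
  fun a b c => op (op a (prime b)) c.

Definition right_modular (S : Type) (op : S -> S -> S) : Prop :=
  forall x y z : S, op (op x y) z = op (op z y) x.

(* The middle bracket reverses its arguments: [x [u z y] v]. *)
Definition semiheap (S : Type) (t : S -> S -> S -> S) : Prop :=
  forall x y z u v : S,
    t (t x y z) u v = t x (t u z y) v /\ t x (t u z y) v = t x y (t z u v).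

(* Main.v *)
(* Since prime is involutive, x'y = y'x gives xy = y'x' = (yx)', whence
   x' = (lx)' = xl.  With y and u replaced by y' and u' the semiheap law
   (((xy')z)u')v = (x((u'z)y'))v becomes ((xy)z)u = x((uz)y) after cancelling
   v = l; setting x = l in it yields right modularity.  Conversely it follows
   from right modularity because both sides equal (xy)'(uz)'. *)
Require Import Defs.
From mathcomp Require Import all_boot.
Set Implicit Arguments.
Unset Strict Implicit.
Unset Printing Implicit Defensive.

Lemma unary_swap (S : Type) (op : S -> S -> S) (prime : S -> S) :
  is_unary_groupoid op prime ->
  forall x y : S, op x y = op (prime y) (prime x).
Proof. by case=> primeK _ swap x y; rewrite swap primeK. Qed.

Lemma prime_right_mul (S : Type) (op : S -> S -> S) (l : S) (prime : S -> S) :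
  left_id l op -> is_unary_groupoid op prime ->
  forall x : S, prime x = op x l.
Proof.
move=> hl hprime x; rewrite (unary_swap hprime).
by case: hprime => _ primeM _; rewrite -primeM hl.
Qed.

(** Both equations of the semiheap law reduce to instances of this prime-free identity. *)
Lemma right_modular_reassoc (S : Type) (op : S -> S -> S) (prime : S -> S) :
  is_unary_groupoid op prime -> right_modular op ->
  forall x y z u : S, op (op (op x y) z) u = op x (op (op u z) y).
Proof.
move=> hprime rm x y z u; rewrite (rm (op x y)) !(unary_swap hprime _ (op _ y)).
by case: hprime => _ primeM _; rewrite !primeM rm.
Qed.

Theorem theorem41 (S : Type) (op : S -> S -> S) (l : S) (prime : S -> S)
    (hl : left_id l op) (hprime : is_unary_groupoid op prime) :
  (forall x : S, prime x = op x l) /\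
  (semiheap (ternary_of op prime) <-> right_modular op).
Proof.
have primeE := prime_right_mul hl hprime.
have [primeK primeM _] := hprime.
split=> //; split=> [sh x y z | rm x y z u v]; rewrite ?/ternary_of.
  (* The primes cancel, leaving ((zy)x)l = ((xy)z)l; right multiplication by [l] is [prime], hence
     injective. *)
  have [+ _] := sh l (prime z) y (prime x) l.
  rewrite /ternary_of !primeM !primeK !hl -!primeE.
  by move/(can_inj primeK).
have reassoc := right_modular_reassoc hprime rm.
split; first by rewrite !primeM primeK -reassoc.
(* [rm z] turns (zu')v into (vu')z, so that [reassoc] applies with xy' as its first factor; both
   sides become (((xy')z)u')v. *)
by rewrite !primeM primeK -reassoc (rm z) -reassoc.
Qed.
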